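(* Let $\mathbb{X}$ be a differential category with differential modality $(\mathsf{S},\mu,\eta,\mathsf{m},\mathsf{u},\mathsf{d})$, and let $(\overline{\mathsf{S}},\overline{\mu},\overline{\eta})$ be the induced monad on $\mathsf{Arr}[\mathbb{X}]$. Then there is an isomorphism of categories $\overline{\mathsf{S}}\text{-}\mathsf{ALG}\cong\mathsf{S}\text{-}\mathsf{DER}$ between the category of $\overline{\mathsf{S}}$-algebras and the category of $\mathsf{S}$-derivations. Explicitly, the following two functors are inverse to each other: \begin{itemize} \item $\mathcal{F}\colon\overline{\mathsf{S}}\text{-}\mathsf{ALG}\to\mathsf{S}\text{-}\mathsf{DER}$, given on objects by $\mathcal{F}\big((\phi\colon A_0\to A_1),(\nu_0,\nu_1)\big)=\big(\phi\colon(A_0,\nu_0)\to(A_1,\alpha_{\nu_1})\big)$ with $\alpha_{\nu_1}=\nu_1\circ(\eta_{A_0}\otimes 1_{A_1})\colon A_0\otimes A_1\to A_1$, and on maps by $\mathcal{F}(f_0,f_1)=(f_0,f_1)$; \item $\mathcal{F}^{-1}\colon\mathsf{S}\text{-}\mathsf{DER}\to\overline{\mathsf{S}}\text{-}\mathsf{ALG}$, given on objects by $\mathcal{F}^{-1}\big(\mathsf{D}\colon(A,\nu)\to(M,\alpha)\big)=\big((\mathsf{D}\colon A\to M),(\nu,\nu_\alpha)\big)$ with $\nu_\alpha=\alpha\circ(\nu\otimes 1_M)\colon\mathsf{S}(A)\otimes M\to M$, and on maps by $\mathcal{F}^{-1}(f,g)=(f,g)$. \end{itemize}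
   Context: Symmetric monoidal categories $(\mathbb{X},\otimes,I)$ are written as strict (associators and unitors treated as identities), with symmetry $\sigma_{A,B}\colon A\otimes B\to B\otimes A$. An additive category is a category enriched over commutative monoids: each hom-set is a commutative monoid $(+,0)$ and composition preserves $+$ and $0$ in each argument (no negatives or biproducts assumed). An additive symmetric monoidal category is a symmetric monoidal category that is additive and such that $\otimes$ of maps preserves $+$ and $0$ in each argument. An algebra modality on a symmetric monoidal category is $(\mathsf{S},\mu,\eta,\mathsf{m},\mathsf{u})$ where $(\mathsf{S},\mu,\eta)$ is a monad ($\mu_A\colon\mathsf{S}\mathsf{S}(A)\to\mathsf{S}(A)$, $\eta_A\colon A\to\mathsf{S}(A)$) and $\mathsf{m}_A\colon\mathsf{S}(A)\otimes\mathsf{S}(A)\to\mathsf{S}(A)$, $\mathsf{u}_A\colon I\to\mathsf{S}(A)$ are natural transformations such that each $(\mathsf{S}(A),\mathsf{m}_A,\mathsf{u}_A)$ is a commutative monoid and each $\mu_A$ is a monoid morphism $(\mathsf{S}\mathsf{S}(A),\mathsf{m}_{\mathsf{S}(A)},\mathsf{u}_{\mathsf{S}(A)})\to(\mathsf{S}(A),\mathsf{m}_A,\mathsf{u}_A)$. A differential modality on an additive symmetric monoidal category is an algebra modality with a natural transformation $\mathsf{d}_A\colon\mathsf{S}(A)\to\mathsf{S}(A)\otimes A$ (the deriving transformation) such that [D.1] $\mathsf{d}_A\circ\mathsf{u}_A=0$; [D.2] $\mathsf{d}_A\circ\mathsf{m}_A=(\mathsf{m}_A\otimes 1_A)\circ\big((1_{\mathsf{S}(A)}\otimes\mathsf{d}_A)+(1_{\mathsf{S}(A)}\otimes\sigma_{A,\mathsf{S}(A)})\circ(\mathsf{d}_A\otimes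 1_{\mathsf{S}(A)})\big)$; [D.3] $\mathsf{d}_A\circ\eta_A=\mathsf{u}_A\otimes 1_A$; [D.4] $\mathsf{d}_A\circ\mu_A=(\mathsf{m}_A\otimes 1_A)\circ(\mu_A\otimes\mathsf{d}_A)\circ\mathsf{d}_{\mathsf{S}(A)}$; [D.5] $(1_{\mathsf{S}(A)}\otimes\sigma_{A,A})\circ(\mathsf{d}_A\otimes 1_A)\circ\mathsf{d}_A=(\mathsf{d}_A\otimes 1_A)\circ\mathsf{d}_A$. A differential category is an additive symmetric monoidal category equipped with a differential modality. The arrow category $\mathsf{Arr}[\mathbb{X}]$ has as objects the maps $\phi\colon A_0\to A_1$ of $\mathbb{X}$ and as maps $\phi\to\phi'$ the pairs $(f_0\colon A_0\to A_0',\ f_1\colon A_1\to A_1')$ with $f_1\circ\phi=\phi'\circ f_0$; composition and identities are componentwise. The monad $(\overline{\mathsf{S}},\overline{\mu},\overline{\eta})$ on $\mathsf{Arr}[\mathbb{X}]$ is: $\overline{\mathsf{S}}(\phi\colon A_0\to A_1)=\big((1_{\mathsf{S}(A_0)}\otimes\phi)\circ\mathsf{d}_{A_0}\colon \mathsf{S}(A_0)\to \mathsf{S}(A_0)\otimes A_1\big)$, $\overline{\mathsf{S}}(f_0,f_1)=(\mathsf{S}(f_0),\mathsf{S}(f_0)\otimes f_1)$, $\overline{\eta}_{\phi}=(\eta_{A_0},\mathsf{u}_{A_0}\otimes 1_{A_1})$, $\overline{\mu}_{\phi}=\big(\mu_{A_0},(\mathsf{m}_{A_0}\otimes 1_{A_1})\circ(\mu_{A_0}\otimes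 1_{\mathsf{S}(A_0)}\otimes 1_{A_1})\big)$. For a monad, algebras and algebra morphisms are the Eilenberg–Moore ones, forming the category $\mathsf{S}\text{-}\mathsf{ALG}$ (resp. $\overline{\mathsf{S}}\text{-}\mathsf{ALG}$). An $\overline{\mathsf{S}}$-algebra is written $\big((\phi\colon A_0\to A_1),(\nu_0,\nu_1)\big)$ with $\nu_0\colon\mathsf{S}(A_0)\to A_0$ and $\nu_1\colon\mathsf{S}(A_0)\otimes A_1\to A_1$. Every $\mathsf{S}$-algebra $(A,\nu)$ carries a commutative monoid structure $(A,\mathsf{m}^\nu,\mathsf{u}^\nu)$ with $\mathsf{m}^\nu=\nu\circ\mathsf{m}_A\circ(\eta_A\otimes\eta_A)$ and $\mathsf{u}^\nu=\nu\circ\mathsf{u}_A$. A module over a commutative monoid $(A,\mathsf{m},\mathsf{u})$ is $(M,\alpha\colon A\otimes M\to M)$ with $\alpha\circ(1_A\otimes\alpha)=\alpha\circ(\mathsf{m}\otimes 1_M)$ and $\alpha\circ(\mathsf{u}\otimes 1_M)=1_M$; an $(A,\nu)$-module means an $(A,\mathsf{m}^\nu,\mathsf{u}^\nu)$-module. An $\mathsf{S}$-derivation $\mathsf{D}\colon(A,\nu)\to(M,\alpha)$, for an $\mathsf{S}$-algebra $(A,\nu)$ and an $(A,\nu)$-module $(M,\alpha)$, is a map $\mathsf{D}\colon A\to M$ with $\mathsf{D}\circ\nu=\alpha\circ(\nu\otimes\mathsf{D})\circ\mathsf{d}_A$. An $\mathsf{S}$-derivation morphism from $\mathsf{D}\colon(A,\nu)\to(M,\alpha)$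 to $\mathsf{D}'\colon(A',\nu')\to(M',\alpha')$ is a pair $(f,g)$ with $f\colon(A,\nu)\to(A',\nu')$ an $\mathsf{S}$-algebra morphism and $g\colon M\to M'$ a map such that $g\circ\alpha=\alpha'\circ(f\otimes g)$ and $g\circ\mathsf{D}=\mathsf{D}'\circ f$. These form the category $\mathsf{S}\text{-}\mathsf{DER}$. *)

(* Defs.v *)
From Stdlib Require Import ssreflect ProofIrrelevance.
Set Implicit Arguments.
Unset Strict Implicit.
Unset Printing Implicit Defensive.

Declare Scope cat_scope.
Delimit Scope cat_scope with cat.
Local Open Scope cat_scope.

Record Category := {
  Ob :> Type;
  Hom : Ob -> Ob -> Type;
  idm : forall A, Hom A A;
  comp : forall A B C, Hom B C -> Hom A B -> Hom A C;
  comp_idl : forall A B (f : Hom A B), comp (idm B) f = f;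
  comp_idr : forall A B (f : Hom A B), comp f (idm A) = f;
  comp_assoc : forall A B C D (h : Hom C D) (g : Hom B C) (f : Hom A B),
    comp h (comp g f) = comp (comp h g) f }.
Arguments Hom {c} A B.
Arguments idm {c} A.
Arguments comp {c A B C} g f.

Notation "g ∘ f" := (comp g f) (at level 40, left associativity) : cat_scope.
Notation "1_ A" := (idm A) (at level 8, A at level 2, format "1_ A") : cat_scope.

Record Functor (C D : Category) := {
  fob :> C -> D;
  fmap : forall A B, Hom A B -> Hom (fob A) (fob B);
  fmap_id : forall A, fmap (1_A) = 1_(fob A);
  fmap_comp : forall A B E (g : Hom B E) (f : Hom A B),
    fmap (g ∘ f) = fmap g ∘ fmap f }.
Arguments fmap {C D} _ {A B} _.

Definition functor_id (C : Category) : Functor C C :=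
  {| fob := fun A => A; fmap := fun A B f => f;
     fmap_id := fun A => eq_refl; fmap_comp := fun A B E g f => eq_refl |}.

Definition functor_comp (C D E : Category) (G : Functor D E) (F : Functor C D) :
  Functor C E.
Proof.
refine {| fob := fun A => G (F A); fmap := fun A B f => fmap G (fmap F f) |}.
- by move=> A; rewrite !fmap_id.
- by move=> A B H g f; rewrite !fmap_comp.
Defined.

Record Monad (C : Category) := {
  mon_fun :> Functor C C;
  mon_mu : forall A, Hom (mon_fun (mon_fun A)) (mon_fun A);
  mon_eta : forall A, Hom A (mon_fun A);
  mon_mu_nat : forall A B (f : Hom A B),
    mon_mu B ∘ fmap mon_fun (fmap mon_fun f) = fmap mon_fun f ∘ mon_mu A;
  mon_eta_nat : forall A B (f : Hom A B),
    mon_eta B ∘ f = fmap mon_fun f ∘ mon_eta A;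
  mon_assoc : forall A, mon_mu A ∘ mon_mu (mon_fun A) = mon_mu A ∘ fmap mon_fun (mon_mu A);
  mon_unitl : forall A, mon_mu A ∘ mon_eta (mon_fun A) = 1_(mon_fun A);
  mon_unitr : forall A, mon_mu A ∘ fmap mon_fun (mon_eta A) = 1_(mon_fun A) }.
Arguments mon_mu {C} m A.
Arguments mon_eta {C} m A.

Record Alg (C : Category) (T : Monad C) := {
  alg_ob : C;
  alg_str : Hom (T alg_ob) alg_ob;
  alg_assoc : alg_str ∘ mon_mu T alg_ob = alg_str ∘ fmap T alg_str;
  alg_unit : alg_str ∘ mon_eta T alg_ob = 1_alg_ob }.

Record AlgHom (C : Category) (T : Monad C) (X Y : Alg T) := {
  ah_map : Hom (alg_ob X) (alg_ob Y);
  ah_comm : ah_map ∘ alg_str X = alg_str Y ∘ fmap T ah_map }.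

Lemma AlgHom_ext (C : Category) (T : Monad C) (X Y : Alg T) (f g : AlgHom X Y) :
  ah_map f = ah_map g -> f = g.
Proof.
case: f => f Hf; case: g => g Hg /= E; subst g; by rewrite (proof_irrelevance _ Hf Hg).
Qed.

Definition alghom_id (C : Category) (T : Monad C) (X : Alg T) : AlgHom X X.
Proof.
refine {| ah_map := 1_(alg_ob X) |}; by rewrite fmap_id comp_idl comp_idr.
Defined.

Definition alghom_comp (C : Category) (T : Monad C) (X Y Z : Alg T)
  (g : AlgHom Y Z) (f : AlgHom X Y) : AlgHom X Z.
Proof.
refine {| ah_map := ah_map g ∘ ah_map f |}.
by rewrite -comp_assoc ah_comm comp_assoc ah_comm fmap_comp comp_assoc.
Defined.

Definition ALG (C : Category) (T : Monad C) : Category.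
Proof.
refine {| Ob := Alg T; Hom := @AlgHom C T;
          idm := @alghom_id C T; comp := @alghom_comp C T |}.
- by move=> X Y f; apply: AlgHom_ext; apply: comp_idl.
- by move=> X Y f; apply: AlgHom_ext; apply: comp_idr.
- by move=> X Y Z W h g f; apply: AlgHom_ext; apply: comp_assoc.
Defined.

Record ArrOb (C : Category) := {
  arr0 : C; arr1 : C; arr_map : Hom arr0 arr1 }.

Record ArrHom (C : Category) (X Y : ArrOb C) := {
  arh0 : Hom (arr0 X) (arr0 Y);
  arh1 : Hom (arr1 X) (arr1 Y);
  arh_comm : arh1 ∘ arr_map X = arr_map Y ∘ arh0 }.

Lemma ArrHom_ext (C : Category) (X Y : ArrOb C) (f g : ArrHom X Y) :
  arh0 f = arh0 g -> arh1 f = arh1 g -> f = g.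
Proof.
case: f => f0 f1 Hf; case: g => g0 g1 Hg /= E0 E1; subst g0 g1.
by rewrite (proof_irrelevance _ Hf Hg).
Qed.

Definition arrhom_id (C : Category) (X : ArrOb C) : ArrHom X X.
Proof.
refine {| arh0 := 1_(arr0 X); arh1 := 1_(arr1 X) |}; by rewrite comp_idl comp_idr.
Defined.

Definition arrhom_comp (C : Category) (X Y Z : ArrOb C)
  (g : ArrHom Y Z) (f : ArrHom X Y) : ArrHom X Z.
Proof.
refine {| arh0 := arh0 g ∘ arh0 f; arh1 := arh1 g ∘ arh1 f |}.
by rewrite -comp_assoc arh_comm comp_assoc arh_comm comp_assoc.
Defined.

Definition Arr (C : Category) : Category.
Proof.
refine {| Ob := ArrOb C; Hom := @ArrHom C;
          idm := @arrhom_id C; comp := @arrhom_comp C |}.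
- by move=> X Y f; apply: ArrHom_ext; apply: comp_idl.
- by move=> X Y f; apply: ArrHom_ext; apply: comp_idr.
- by move=> X Y Z W h g f; apply: ArrHom_ext; apply: comp_assoc.
Defined.

(** Not assumed strict: an on-the-nose equality of objects such as
    [A ⊗ (B ⊗ C) = (A ⊗ B) ⊗ C] would force transports in every law, so the
    associator [assoc] and the unitors [lunit], [runit] are kept explicit and
    inserted in all formulas below. A strict category is the case where they
    are identities. *)
Record SymMonCat := {
  smc_cat :> Category;
  unitob : smc_cat;
  tens : smc_cat -> smc_cat -> smc_cat;
  tensm : forall A A' B B' : smc_cat,
    Hom A A' -> Hom B B' -> Hom (tens A B) (tens A' B');
  tensm_id : forall A B, tensm (1_A) (1_B) = 1_(tens A B);
  tensm_comp : forall A A' A'' B B' B'' (f' : Hom A' A'') (f : Hom A A')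
      (g' : Hom B' B'') (g : Hom B B'),
    tensm (f' ∘ f) (g' ∘ g) = tensm f' g' ∘ tensm f g;

  assoc : forall A B C, Hom (tens (tens A B) C) (tens A (tens B C));
  assoc_inv : forall A B C, Hom (tens A (tens B C)) (tens (tens A B) C);
  lunit : forall A, Hom (tens unitob A) A;
  lunit_inv : forall A, Hom A (tens unitob A);
  runit : forall A, Hom (tens A unitob) A;
  runit_inv : forall A, Hom A (tens A unitob);
  symm : forall A B, Hom (tens A B) (tens B A);

  assocK : forall A B C, assoc_inv A B C ∘ assoc A B C = 1_(tens (tens A B) C);
  assoc_invK : forall A B C, assoc A B C ∘ assoc_inv A B C = 1_(tens A (tens B C));
  lunitK : forall A, lunit_inv A ∘ lunit A = 1_(tens unitob A);
  lunit_invK : forall A, lunit A ∘ lunit_inv A = 1_A;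
  runitK : forall A, runit_inv A ∘ runit A = 1_(tens A unitob);
  runit_invK : forall A, runit A ∘ runit_inv A = 1_A;
  symmK : forall A B, symm B A ∘ symm A B = 1_(tens A B);

  assoc_nat : forall A A' B B' C C' (f : Hom A A') (g : Hom B B') (h : Hom C C'),
    assoc A' B' C' ∘ tensm (tensm f g) h = tensm f (tensm g h) ∘ assoc A B C;
  lunit_nat : forall A A' (f : Hom A A'),
    lunit A' ∘ tensm (1_unitob) f = f ∘ lunit A;
  runit_nat : forall A A' (f : Hom A A'),
    runit A' ∘ tensm f (1_unitob) = f ∘ runit A;
  symm_nat : forall A A' B B' (f : Hom A A') (g : Hom B B'),
    symm A' B' ∘ tensm f g = tensm g f ∘ symm A B;

  pentagon : forall A B C D,
    assoc A B (tens C D) ∘ assoc (tens A B) C D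
    = tensm (1_A) (assoc B C D) ∘ assoc A (tens B C) D ∘ tensm (assoc A B C) (1_D);
  triangle : forall A B,
    tensm (1_A) (lunit B) ∘ assoc A unitob B = tensm (runit A) (1_B);
  hexagon : forall A B C,
    assoc B C A ∘ symm A (tens B C) ∘ assoc A B C
    = tensm (1_B) (symm A C) ∘ assoc B A C ∘ tensm (symm A B) (1_C) }.
Arguments unitob {s}.
Arguments tens {s} A B.
Arguments tensm {s A A' B B'} f g.
Arguments assoc {s} A B C.
Arguments assoc_inv {s} A B C.
Arguments lunit {s} A.
Arguments lunit_inv {s} A.
Arguments runit {s} A.
Arguments runit_inv {s} A.
Arguments symm {s} A B.

Notation "A ⊗ B" := (tens A B) (at level 34, left associativity) : cat_scope.
Notation "f ⊠ g" := (tensm f g) (at level 34, left associativity) : cat_scope.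

Record IsCommMonoid (X : SymMonCat) (A : X) (m : Hom (A ⊗ A) A) (u : Hom unitob A) : Prop := {
  cmon_assoc : m ∘ (m ⊠ 1_A) = m ∘ (1_A ⊠ m) ∘ assoc A A A;
  cmon_unitl : m ∘ (u ⊠ 1_A) = lunit A;
  cmon_unitr : m ∘ (1_A ⊠ u) = runit A;
  cmon_comm : m ∘ symm A A = m }.

Record IsMonoidHom (X : SymMonCat) (A B : X)
    (mA : Hom (A ⊗ A) A) (uA : Hom unitob A)
    (mB : Hom (B ⊗ B) B) (uB : Hom unitob B) (f : Hom A B) : Prop := {
  mhom_mul : f ∘ mA = mB ∘ (f ⊠ f);
  mhom_unit : f ∘ uA = uB }.

Record CommMonoid (X : SymMonCat) := {
  cmon_ob : X;
  cmon_mul : Hom (cmon_ob ⊗ cmon_ob) cmon_ob;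
  cmon_one : Hom unitob cmon_ob;
  cmonP : IsCommMonoid cmon_mul cmon_one }.

Record Module (X : SymMonCat) (A : CommMonoid X) := {
  mod_ob : X;
  mod_act : Hom (cmon_ob A ⊗ mod_ob) mod_ob;
  mod_assoc :
    mod_act ∘ (1_(cmon_ob A) ⊠ mod_act) ∘ assoc (cmon_ob A) (cmon_ob A) mod_ob
    = mod_act ∘ (cmon_mul A ⊠ 1_mod_ob);
  mod_unit : mod_act ∘ (cmon_one A ⊠ 1_mod_ob) ∘ lunit_inv mod_ob = 1_mod_ob }.

Record AlgebraModality (X : SymMonCat) := {
  am_monad :> Monad X;
  am_m : forall A : X, Hom (am_monad A ⊗ am_monad A) (am_monad A);
  am_u : forall A : X, Hom unitob (am_monad A);
  am_m_nat : forall (A B : X) (f : Hom A B),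
    am_m B ∘ (fmap am_monad f ⊠ fmap am_monad f) = fmap am_monad f ∘ am_m A;
  am_u_nat : forall (A B : X) (f : Hom A B), fmap am_monad f ∘ am_u A = am_u B;
  am_cmon : forall A : X, IsCommMonoid (am_m A) (am_u A);
  am_mu_hom : forall A : X,
    IsMonoidHom (am_m (am_monad A)) (am_u (am_monad A)) (am_m A) (am_u A)
                (mon_mu am_monad A) }.
Arguments am_m {X} a A.
Arguments am_u {X} a A.

Record AdditiveStructure (C : Category) := {
  hadd_of : forall A B : C, Hom A B -> Hom A B -> Hom A B;
  hzero_of : forall A B : C, Hom A B;
  hadd_assoc : forall (A B : C) (f g h : Hom A B),
    hadd_of f (hadd_of g h) = hadd_of (hadd_of f g) h;
  hadd_comm : forall (A B : C) (f g : Hom A B), hadd_of f g = hadd_of g f;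
  hadd_zero : forall (A B : C) (f : Hom A B), hadd_of (hzero_of A B) f = f;
  comp_addl : forall (A B E : C) (g g' : Hom B E) (f : Hom A B),
    hadd_of g g' ∘ f = hadd_of (g ∘ f) (g' ∘ f);
  comp_addr : forall (A B E : C) (g : Hom B E) (f f' : Hom A B),
    g ∘ hadd_of f f' = hadd_of (g ∘ f) (g ∘ f');
  comp_zerol : forall (A B E : C) (f : Hom A B), hzero_of B E ∘ f = hzero_of A E;
  comp_zeror : forall (A B E : C) (g : Hom B E), g ∘ hzero_of A B = hzero_of A E }.

Record AddSymMonCat := {
  asmc_smc :> SymMonCat;
  asmc_add : AdditiveStructure asmc_smc;
  tens_addl : forall (A A' B B' : asmc_smc) (f f' : Hom A A') (g : Hom B B'),
    hadd_of asmc_add f f' ⊠ g = hadd_of asmc_add (f ⊠ g) (f' ⊠ g);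
  tens_addr : forall (A A' B B' : asmc_smc) (f : Hom A A') (g g' : Hom B B'),
    f ⊠ hadd_of asmc_add g g' = hadd_of asmc_add (f ⊠ g) (f ⊠ g');
  tens_zerol : forall (A A' B B' : asmc_smc) (g : Hom B B'),
    hzero_of asmc_add A A' ⊠ g = hzero_of asmc_add (A ⊗ B) (A' ⊗ B');
  tens_zeror : forall (A A' B B' : asmc_smc) (f : Hom A A'),
    f ⊠ hzero_of asmc_add B B' = hzero_of asmc_add (A ⊗ B) (A' ⊗ B') }.

Definition hadd (X : AddSymMonCat) (A B : X) (f g : Hom A B) : Hom A B :=
  hadd_of (asmc_add X) f g.
Definition hzero (X : AddSymMonCat) (A B : X) : Hom A B := hzero_of (asmc_add X) A B.
Arguments hzero {X} A B.

Notation "f + g" := (hadd f g) : cat_scope.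

Record DifferentialModality (X : AddSymMonCat) := {
  dm_am :> AlgebraModality X;
  dm_d : forall A : X, Hom (dm_am A) (dm_am A ⊗ A);
  dm_d_nat : forall (A B : X) (f : Hom A B),
    dm_d B ∘ fmap dm_am f = (fmap dm_am f ⊠ f) ∘ dm_d A;
  dm_D1 : forall A : X, dm_d A ∘ am_u dm_am A = hzero unitob (dm_am A ⊗ A);
  dm_D2 : forall A : X,
    dm_d A ∘ am_m dm_am A
    = (am_m dm_am A ⊠ 1_A) ∘ assoc_inv (dm_am A) (dm_am A) A
      ∘ ((1_(dm_am A) ⊠ dm_d A)
         + (1_(dm_am A) ⊠ symm A (dm_am A)) ∘ assoc (dm_am A) A (dm_am A)
           ∘ (dm_d A ⊠ 1_(dm_am A)));
  dm_D3 : forall A : X, dm_d A ∘ mon_eta dm_am A = (am_u dm_am A ⊠ 1_A) ∘ lunit_inv A;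
  dm_D4 : forall A : X,
    dm_d A ∘ mon_mu dm_am A
    = (am_m dm_am A ⊠ 1_A) ∘ assoc_inv (dm_am A) (dm_am A) A
      ∘ (mon_mu dm_am A ⊠ dm_d A) ∘ dm_d (dm_am A);
  dm_D5 : forall A : X,
    (1_(dm_am A) ⊠ symm A A) ∘ assoc (dm_am A) A A ∘ (dm_d A ⊠ 1_A) ∘ dm_d A
    = assoc (dm_am A) A A ∘ (dm_d A ⊠ 1_A) ∘ dm_d A }.
Arguments dm_d {X} d A.

Record DifferentialCategory := {
  dc_cat :> AddSymMonCat;
  dc_mod : DifferentialModality dc_cat }.

Section Coherence.
Variable X : SymMonCat.
Implicit Types A B C D : X.

Lemma tens1_comp A B C D (g : Hom C D) (f : Hom B C) :
  (1_A ⊠ g) ∘ (1_A ⊠ f) = 1_A ⊠ (g ∘ f).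
Proof. by rewrite -tensm_comp comp_idl. Qed.

Lemma tens_comp1 A B C D (g : Hom C D) (f : Hom B C) :
  (g ⊠ 1_A) ∘ (f ⊠ 1_A) = (g ∘ f) ⊠ 1_A.
Proof. by rewrite -tensm_comp comp_idl. Qed.

Lemma iso_epi A B C (f : Hom A B) (g : Hom B A) (h k : Hom B C) :
  f ∘ g = 1_B -> h ∘ f = k ∘ f -> h = k.
Proof. by move=> fg E; rewrite -(comp_idr h) -(comp_idr k) -fg !comp_assoc E. Qed.

Lemma comp_cancel A B C (h : Hom B C) (f : Hom A B) (g : Hom B A) :
  f ∘ g = 1_B -> h ∘ f ∘ g = h.
Proof. by move=> fg; rewrite -comp_assoc fg comp_idr. Qed.

Lemma assoc_inv_nat A A' B B' C C' (f : Hom A A') (g : Hom B B') (h : Hom C C') :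
  assoc_inv A' B' C' ∘ (f ⊠ (g ⊠ h)) = (f ⊠ g ⊠ h) ∘ assoc_inv A B C.
Proof.
apply: (iso_epi (assoc_invK A B C)).
rewrite -comp_assoc -assoc_nat comp_assoc assocK comp_idl.
by rewrite -comp_assoc assocK comp_idr.
Qed.

Lemma lunit_inv_nat A A' (f : Hom A A') :
  lunit_inv A' ∘ f = (1_unitob ⊠ f) ∘ lunit_inv A.
Proof.
apply: (iso_epi (lunit_invK A)).
rewrite -comp_assoc -lunit_nat comp_assoc lunitK comp_idl.
by rewrite -comp_assoc lunitK comp_idr.
Qed.

Lemma tens_unit_faithful A B (f g : Hom A B) :
  1_unitob ⊠ f = 1_unitob ⊠ g -> f = g.
Proof.
by move=> E; apply: (iso_epi (lunit_invK A)); rewrite -!lunit_nat E.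
Qed.

Lemma lunit_assoc A B : lunit (A ⊗ B) ∘ assoc unitob A B = lunit A ⊠ 1_B.
Proof.
apply: tens_unit_faithful; rewrite -tens1_comp.
apply: (iso_epi (assoc_invK unitob (unitob ⊗ A) B)).
have isoa : (assoc unitob unitob A ⊠ 1_B) ∘ (assoc_inv unitob unitob A ⊠ 1_B)
    = 1_(unitob ⊗ (unitob ⊗ A) ⊗ B).
  by rewrite tens_comp1 assoc_invK tensm_id.
apply: (iso_epi isoa).
rewrite -!comp_assoc (comp_assoc (1_unitob ⊠ assoc unitob A B)) -pentagon.
rewrite comp_assoc triangle -tensm_id -assoc_nat.
rewrite (comp_assoc (1_unitob ⊠ (lunit A ⊠ 1_B))) -assoc_nat -comp_assoc tens_comp1.
by rewrite triangle.
Qed.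

Lemma assoc_inv_lunit A B :
  (lunit A ⊠ 1_B) ∘ assoc_inv unitob A B ∘ lunit_inv (A ⊗ B) = 1_(A ⊗ B).
Proof.
rewrite -lunit_assoc -(comp_assoc (lunit _)) assoc_invK comp_idr.
by rewrite lunit_invK.
Qed.

Lemma assoc_inv_triangle A B :
  (runit A ⊠ 1_B) ∘ assoc_inv A unitob B ∘ (1_A ⊠ lunit_inv B) = 1_(A ⊗ B).
Proof.
rewrite -triangle -(comp_assoc (1_A ⊠ lunit B)) assoc_invK comp_idr.
by rewrite tens1_comp lunit_invK tensm_id.
Qed.

Lemma assoc_inv_pentagon A B C D :
  (assoc_inv A B C ⊠ 1_D) ∘ assoc_inv A (B ⊗ C) D ∘ (1_A ⊠ assoc_inv B C D)
  = assoc_inv (A ⊗ B) C D ∘ assoc_inv A B (C ⊗ D).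
Proof.
have Hr : (assoc A B (C ⊗ D) ∘ assoc (A ⊗ B) C D)
    ∘ (assoc_inv (A ⊗ B) C D ∘ assoc_inv A B (C ⊗ D)) = 1_(A ⊗ (B ⊗ (C ⊗ D))).
  by rewrite !comp_assoc (comp_cancel _ (assoc_invK (A ⊗ B) C D)) assoc_invK.
have Hl : (assoc_inv (A ⊗ B) C D ∘ assoc_inv A B (C ⊗ D))
    ∘ (assoc A B (C ⊗ D) ∘ assoc (A ⊗ B) C D) = 1_(A ⊗ B ⊗ C ⊗ D).
  by rewrite !comp_assoc (comp_cancel _ (assocK A B (C ⊗ D))) assocK.
apply: (iso_epi Hr); rewrite Hl pentagon !comp_assoc.
rewrite -(comp_assoc _ (1_A ⊠ assoc_inv B C D)) tens1_comp assocK tensm_id comp_idr.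
by rewrite (comp_cancel _ (assocK A (B ⊗ C) D)) tens_comp1 assocK tensm_id.
Qed.

End Coherence.

Lemma split_quotient_isCommMonoid (X : SymMonCat) (B A : X)
    (mB : Hom (B ⊗ B) B) (uB : Hom unitob B) (mA : Hom (A ⊗ A) A)
    (q : Hom B A) (s : Hom A B) :
  IsCommMonoid mB uB -> q ∘ s = 1_A -> mA ∘ (q ⊠ q) = q ∘ mB ->
  IsCommMonoid mA (q ∘ uB).
Proof.
move=> HB qs hm; split.
- apply: (@iso_epi _ _ _ _ (q ⊠ q ⊠ q) (s ⊠ s ⊠ s)).
    by rewrite -!tensm_comp qs !tensm_id.
  have E1 : (mA ⊠ 1_A) ∘ (q ⊠ q ⊠ q) = (q ⊠ q) ∘ (mB ⊠ 1_B).
    by rewrite -!tensm_comp hm comp_idl comp_idr.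
  have E2 : (1_A ⊠ mA) ∘ (q ⊠ (q ⊠ q)) = (q ⊠ q) ∘ (1_B ⊠ mB).
    by rewrite -!tensm_comp hm comp_idl comp_idr.
  rewrite -!comp_assoc assoc_nat E1 (comp_assoc (1_A ⊠ mA)) E2 !comp_assoc hm.
  by rewrite -!comp_assoc (cmon_assoc HB) -!comp_assoc.
- apply: (@iso_epi _ _ _ _ (1_unitob ⊠ q) (1_unitob ⊠ s)).
    by rewrite -!tensm_comp qs comp_idl tensm_id.
  have E : ((q ∘ uB) ⊠ 1_A) ∘ (1_unitob ⊠ q) = (q ⊠ q) ∘ (uB ⊠ 1_B).
    by rewrite -!tensm_comp comp_idl !comp_idr.
  by rewrite -comp_assoc E comp_assoc hm -comp_assoc (cmon_unitl HB) lunit_nat.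
- apply: (@iso_epi _ _ _ _ (q ⊠ 1_unitob) (s ⊠ 1_unitob)).
    by rewrite -!tensm_comp qs comp_idl tensm_id.
  have E : (1_A ⊠ (q ∘ uB)) ∘ (q ⊠ 1_unitob) = (q ⊠ q) ∘ (1_B ⊠ uB).
    by rewrite -!tensm_comp comp_idl !comp_idr.
  by rewrite -comp_assoc E comp_assoc hm -comp_assoc (cmon_unitr HB) runit_nat.
- apply: (@iso_epi _ _ _ _ (q ⊠ q) (s ⊠ s)).
    by rewrite -!tensm_comp qs tensm_id.
  by rewrite -comp_assoc symm_nat comp_assoc hm -comp_assoc (cmon_comm HB).
Qed.

Section AlgMonoid.
Variables (X : SymMonCat) (S : AlgebraModality X) (A : Alg S).
Let a := alg_ob A.
Let nu : Hom (S a) a := alg_str A.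

Definition alg_mul : Hom (a ⊗ a) a := nu ∘ am_m S a ∘ (mon_eta S a ⊠ mon_eta S a).
Definition alg_one : Hom unitob a := nu ∘ am_u S a.

Lemma alg_mul_str : alg_mul ∘ (nu ⊠ nu) = nu ∘ am_m S a.
Proof.
rewrite /alg_mul -comp_assoc -tensm_comp !mon_eta_nat tensm_comp.
rewrite comp_assoc -(comp_assoc nu) am_m_nat.
have E : nu ∘ (fmap S nu ∘ am_m S (S a)) = nu ∘ am_m S a ∘ (mon_mu S a ⊠ mon_mu S a).
  have E1 : nu ∘ fmap S nu = nu ∘ mon_mu S a by rewrite /nu alg_assoc.
  by rewrite comp_assoc E1 -!comp_assoc (mhom_mul (am_mu_hom S a)).
rewrite E -comp_assoc -tensm_comp mon_unitl tensm_id comp_idr.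
by [].
Qed.

Lemma alg_isCommMonoid : IsCommMonoid alg_mul alg_one.
Proof.
exact: (split_quotient_isCommMonoid (am_cmon S a) (alg_unit A) alg_mul_str).
Qed.

Definition alg_monoid : CommMonoid X :=
  {| cmon_ob := a; cmon_mul := alg_mul; cmon_one := alg_one; cmonP := alg_isCommMonoid |}.

End AlgMonoid.

Section ArrowMonad.
Variables (X : AddSymMonCat) (S : DifferentialModality X).

Definition sbar_ob (p : Arr X) : Arr X :=
  {| arr0 := S (arr0 p);
     arr1 := S (arr0 p) ⊗ arr1 p;
     arr_map := (1_(S (arr0 p)) ⊠ arr_map p) ∘ dm_d S (arr0 p) |}.

Definition sbar_map (p q : Arr X) (f : Hom p q) : Hom (sbar_ob p) (sbar_ob q).
Proof.
refine (Build_ArrHom (X := sbar_ob p) (Y := sbar_ob q)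
          (arh0 := fmap S (arh0 f)) (arh1 := fmap S (arh0 f) ⊠ arh1 f) _) => /=.
rewrite -comp_assoc dm_d_nat !comp_assoc -!tensm_comp comp_idl comp_idr.
by rewrite arh_comm.
Defined.

Definition sbar_functor : Functor (Arr X) (Arr X).
Proof.
refine {| fob := sbar_ob; fmap := sbar_map |}.
- by move=> p; apply: ArrHom_ext => /=; rewrite fmap_id ?tensm_id.
- by move=> p q r g f; apply: ArrHom_ext => /=; rewrite fmap_comp ?tensm_comp.
Defined.

Definition sbar_eta (p : Arr X) : Hom p (sbar_functor p).
Proof.
refine (Build_ArrHom (X := p) (Y := sbar_ob p)
          (arh0 := mon_eta S (arr0 p))
          (arh1 := (am_u S (arr0 p) ⊠ 1_(arr1 p)) ∘ lunit_inv (arr1 p)) _) => /=.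
rewrite -!comp_assoc lunit_inv_nat dm_D3 !comp_assoc -!tensm_comp.
by rewrite !comp_idl !comp_idr.
Defined.

Definition sbar_mu (p : Arr X) : Hom (sbar_functor (sbar_functor p)) (sbar_functor p).
Proof.
refine (Build_ArrHom (X := sbar_ob (sbar_ob p)) (Y := sbar_ob p)
          (arh0 := mon_mu S (arr0 p))
          (arh1 := (am_m S (arr0 p) ⊠ 1_(arr1 p))
                   ∘ assoc_inv (S (arr0 p)) (S (arr0 p)) (arr1 p)
                   ∘ (mon_mu S (arr0 p) ⊠ (1_(S (arr0 p)) ⊠ 1_(arr1 p)))) _) => /=.
have E : (1_(S (arr0 p)) ⊠ arr_map p) ∘ (am_m S (arr0 p) ⊠ 1_(arr0 p))
    = (am_m S (arr0 p) ⊠ 1_(arr1 p)) ∘ (1_(S (arr0 p)) ⊠ 1_(S (arr0 p)) ⊠ arr_map p).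
  by rewrite -!tensm_comp tensm_id !comp_idl !comp_idr.
rewrite -[in RHS]comp_assoc dm_D4 !comp_assoc E.
rewrite -[in RHS](comp_assoc _ _ (assoc_inv _ _ _)) -assoc_inv_nat !comp_assoc.
rewrite -(comp_assoc _ (mon_mu S _ ⊠ _)) -tensm_comp comp_idr tensm_id comp_idl.
by rewrite -[in RHS](comp_assoc _ _ (mon_mu S _ ⊠ _)) -tensm_comp comp_idl.
Defined.

Lemma sbar_mu_nat (p q : Arr X) (f : Hom p q) :
  sbar_mu q ∘ fmap sbar_functor (fmap sbar_functor f) = fmap sbar_functor f ∘ sbar_mu p.
Proof.
apply: ArrHom_ext => /=; first exact: mon_mu_nat.
have E : (fmap S (arh0 f) ⊠ arh1 f) ∘ (am_m S (arr0 p) ⊠ 1_(arr1 p))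
    = (am_m S (arr0 q) ⊠ 1_(arr1 q)) ∘ (fmap S (arh0 f) ⊠ fmap S (arh0 f) ⊠ arh1 f).
  by rewrite -!tensm_comp am_m_nat comp_idl comp_idr.
rewrite !comp_assoc E -(comp_assoc _ _ (assoc_inv _ _ (arr1 p))) -assoc_inv_nat.
rewrite !comp_assoc -!(comp_assoc (_ ∘ assoc_inv _ _ _)) -!tensm_comp.
by rewrite mon_mu_nat !comp_idl !comp_idr.
Qed.

Lemma sbar_eta_nat (p q : Arr X) (f : Hom p q) :
  sbar_eta q ∘ f = fmap sbar_functor f ∘ sbar_eta p.
Proof.
apply: ArrHom_ext => /=; first exact: mon_eta_nat.
rewrite -comp_assoc lunit_inv_nat !comp_assoc -!tensm_comp.
by rewrite am_u_nat !comp_idl !comp_idr.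
Qed.

Lemma sbar_mu_assoc (p : Arr X) :
  sbar_mu p ∘ sbar_mu (sbar_functor p) = sbar_mu p ∘ fmap sbar_functor (sbar_mu p).
Proof.
apply: ArrHom_ext => /=; first exact: mon_assoc.
set A := arr0 p; set B := arr1 p.
rewrite !tensm_id.
set Z := mon_mu S A ∘ mon_mu S (S A).
set W := mon_mu S A ⊠ 1_(S A ⊗ B).
transitivity ((am_m S A ⊠ 1_B) ∘ assoc_inv (S A) (S A) B ∘ (1_(S A) ⊠ (am_m S A ⊠ 1_B))
   ∘ (1_(S A) ⊠ assoc_inv (S A) (S A) B) ∘ (Z ⊠ W)); last first.
  rewrite -!comp_assoc; congr (_ ∘ (_ ∘ _)).
  by rewrite -!tensm_comp /Z mon_assoc !comp_idl.
have E1 : W ∘ (am_m S (S A) ⊠ 1_(S A ⊗ B))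
    = (am_m S A ⊠ (1_(S A) ⊠ 1_B)) ∘ (mon_mu S A ⊠ mon_mu S A ⊠ 1_(S A ⊗ B)).
  by rewrite /W -!tensm_comp (mhom_mul (am_mu_hom S A)) tensm_id comp_idl.
have E2 : (mon_mu S A ⊠ W) ∘ (mon_mu S (S A) ⊠ 1_(S (S A) ⊗ (S A ⊗ B))) = Z ⊠ W.
  by rewrite -tensm_comp comp_idr.
rewrite !comp_assoc -(comp_assoc _ W) E1 !comp_assoc.
rewrite -(comp_assoc _ (mon_mu S A ⊠ _ ⊠ _)) -assoc_inv_nat.
rewrite -!comp_assoc E2 !comp_assoc; congr (_ ∘ _).
rewrite -!(comp_assoc (am_m S A ⊠ 1_B) (assoc_inv (S A) (S A) B)).
rewrite !assoc_inv_nat !comp_assoc !tens_comp1.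
rewrite (cmon_assoc (am_cmon S A)) -tens_comp1 -!comp_assoc; congr (_ ∘ _).
rewrite -assoc_inv_pentagon !comp_assoc tens_comp1 assoc_invK tensm_id.
by rewrite comp_idl.
Qed.

Lemma sbar_mu_unitl (p : Arr X) :
  sbar_mu p ∘ sbar_eta (sbar_functor p) = idm (sbar_functor p).
Proof.
apply: ArrHom_ext => /=; first exact: mon_unitl.
set A := arr0 p; set B := arr1 p.
rewrite tensm_id comp_assoc -(comp_assoc _ (mon_mu S A ⊠ _)) -tensm_comp.
rewrite (mhom_unit (am_mu_hom S A)) comp_idl -{1}tensm_id.
rewrite -(comp_assoc _ (assoc_inv _ _ _)) assoc_inv_nat comp_assoc tens_comp1.
by rewrite (cmon_unitl (am_cmon S A)) assoc_inv_lunit.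
Qed.

Lemma sbar_mu_unitr (p : Arr X) :
  sbar_mu p ∘ fmap sbar_functor (sbar_eta p) = idm (sbar_functor p).
Proof.
apply: ArrHom_ext => /=; first exact: mon_unitr.
set A := arr0 p; set B := arr1 p.
rewrite -comp_assoc -tensm_comp mon_unitr tensm_id comp_idl -tens1_comp comp_assoc.
rewrite -(comp_assoc _ (assoc_inv _ _ _)) assoc_inv_nat comp_assoc tens_comp1.
by rewrite (cmon_unitr (am_cmon S A)) assoc_inv_triangle.
Qed.

Definition sbar : Monad (Arr X) :=
  {| mon_fun := sbar_functor; mon_mu := sbar_mu; mon_eta := sbar_eta;
     mon_mu_nat := sbar_mu_nat; mon_eta_nat := sbar_eta_nat;
     mon_assoc := sbar_mu_assoc; mon_unitl := sbar_mu_unitl;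
     mon_unitr := sbar_mu_unitr |}.

End ArrowMonad.

Section Derivations.
Variables (X : AddSymMonCat) (S : DifferentialModality X).

Record Der := {
  der_alg : Alg S;
  der_mod : Module (alg_monoid der_alg);
  der_map : Hom (alg_ob der_alg) (mod_ob der_mod);
  der_law : der_map ∘ alg_str der_alg
    = mod_act der_mod ∘ (alg_str der_alg ⊠ der_map) ∘ dm_d S (alg_ob der_alg) }.

Record DerHom (D D' : Der) := {
  dh_alg : AlgHom (der_alg D) (der_alg D');
  dh_mod : Hom (mod_ob (der_mod D)) (mod_ob (der_mod D'));
  dh_act : dh_mod ∘ mod_act (der_mod D)
    = mod_act (der_mod D') ∘ (ah_map dh_alg ⊠ dh_mod);
  dh_comm : dh_mod ∘ der_map D = der_map D' ∘ ah_map dh_alg }.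

Lemma DerHom_ext (D D' : Der) (f g : DerHom D D') :
  ah_map (dh_alg f) = ah_map (dh_alg g) -> dh_mod f = dh_mod g -> f = g.
Proof.
case: f => f0 f1 Hf Kf; case: g => g0 g1 Hg Kg /= E0 E1.
move: (AlgHom_ext E0) => E; subst g0 g1.
by rewrite (proof_irrelevance _ Hf Hg) (proof_irrelevance _ Kf Kg).
Qed.

Definition derhom_id (D : Der) : DerHom D D.
Proof.
refine {| dh_alg := alghom_id (der_alg D); dh_mod := 1_(mod_ob (der_mod D)) |} => /=.
- by rewrite tensm_id comp_idl comp_idr.
- by rewrite comp_idl comp_idr.
Defined.

Definition derhom_comp (D D' D'' : Der) (g : DerHom D' D'') (f : DerHom D D') :
  DerHom D D''.
Proof.
refine {| dh_alg := alghom_comp (dh_alg g) (dh_alg f);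
          dh_mod := dh_mod g ∘ dh_mod f |} => /=.
- by rewrite -comp_assoc dh_act comp_assoc dh_act tensm_comp comp_assoc.
- by rewrite -comp_assoc dh_comm comp_assoc dh_comm comp_assoc.
Defined.

Definition DER : Category.
Proof.
refine {| Ob := Der; Hom := DerHom; idm := derhom_id; comp := derhom_comp |}.
- by move=> D D' f; apply: DerHom_ext; apply: comp_idl.
- by move=> D D' f; apply: DerHom_ext; apply: comp_idr.
- by move=> D D' D'' D''' h g f; apply: DerHom_ext; apply: comp_assoc.
Defined.

End Derivations.

(** An object of [ALG (sbar S)] or [DER S] bundles its structure maps with
    proofs of laws, and the types of those laws (for [Der], even the type of
    the module) depend on the maps. The records below forget the laws, so that
    "this object is given by these maps" is an ordinary equation. Each of the
    two forgetful maps on objects is injective, and each of those on maps is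
    injective on every hom-set. *)
Section Data.
Variables (X : AddSymMonCat) (S : DifferentialModality X).

Record SbarAlgData := MkSbarAlgData {
  sd_A0 : X; sd_A1 : X;
  sd_phi : Hom sd_A0 sd_A1;
  sd_nu0 : Hom (S sd_A0) sd_A0;
  sd_nu1 : Hom (S sd_A0 ⊗ sd_A1) sd_A1 }.

Record DerData := MkDerData {
  dd_A : X; dd_M : X;
  dd_nu : Hom (S dd_A) dd_A;
  dd_alpha : Hom (dd_A ⊗ dd_M) dd_M;
  dd_D : Hom dd_A dd_M }.

Record MapPair := MkMapPair {
  mp_src0 : X; mp_src1 : X; mp_tgt0 : X; mp_tgt1 : X;
  mp_0 : Hom mp_src0 mp_tgt0;
  mp_1 : Hom mp_src1 mp_tgt1 }.

Definition sbar_alg_data (P : ALG (sbar S)) : SbarAlgData :=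
  {| sd_phi := arr_map (alg_ob P);
     sd_nu0 := arh0 (alg_str P);
     sd_nu1 := arh1 (alg_str P) |}.

Definition der_data (D : DER S) : DerData :=
  {| dd_nu := alg_str (der_alg D);
     dd_alpha := mod_act (der_mod D);
     dd_D := der_map D |}.

Definition sbar_alg_maps (P Q : ALG (sbar S)) (f : Hom P Q) : MapPair :=
  {| mp_0 := arh0 (ah_map f); mp_1 := arh1 (ah_map f) |}.

Definition der_maps (D D' : DER S) (f : Hom D D') : MapPair :=
  {| mp_0 := ah_map (dh_alg f); mp_1 := dh_mod f |}.

Definition der_data_of_sbar (P : SbarAlgData) : DerData :=
  {| dd_nu := sd_nu0 P;
     dd_alpha := sd_nu1 P ∘ (mon_eta S (sd_A0 P) ⊠ 1_(sd_A1 P));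
     dd_D := sd_phi P |}.

Definition sbar_data_of_der (D : DerData) : SbarAlgData :=
  {| sd_phi := dd_D D;
     sd_nu0 := dd_nu D;
     sd_nu1 := dd_alpha D ∘ (dd_nu D ⊠ 1_(dd_M D)) |}.

End Data.

(* Main.v *)
From Stdlib Require Import ssreflect ProofIrrelevance FunctionalExtensionality.
Require Import Defs.
Set Implicit Arguments.
Unset Strict Implicit.
Unset Printing Implicit Defensive.
Local Open Scope cat_scope.

(** The associativity of an [sbar S]-algebra structure [(nu0, nu1)] relates
    [nu1] to the action of [S A0 ⊗ S A0], so restricting it along the units
    [eta] and [u] gives [nu1 = nu1 ∘ (eta ∘ nu0 ⊠ 1)]. Thus [nu1] is recovered
    from [nu0] and the action [alpha = nu1 ∘ (eta ⊠ 1)] of [A0] on [A1], and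
    the remaining laws of [(nu0, nu1)] become exactly those saying that
    [alpha] is a module structure and that the arrow is a derivation. *)

(** [fmap F f] and [fmap G f] live in different hom-types until the object parts are identified.
    Comparing their images in one fixed type [T] lets the hypothesis be stated without transports;
    injectivity on each hom-set then recovers the equality. *)
Lemma functor_ext_data (C D : Category) (T : Type)
    (data : forall A B : D, Hom A B -> T)
    (data_inj : forall (A B : D) (f g : Hom A B), data A B f = data A B g -> f = g)
    (F G : Functor C D) :
  (forall A, F A = G A) ->
  (forall A B (f : Hom A B), data _ _ (fmap F f) = data _ _ (fmap G f)) ->
  F = G.
Proof.
case: F => F0 F1 Fi Fc; case: G => G0 G1 Gi Gc /= E0 E1.
have E : F0 = G0 by apply: functional_extensionality.
subst G0; clear E0.
have E : F1 = G1.
  do 3 (apply: functional_extensionality_dep => ?).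
  exact: data_inj (E1 _ _ _).
subst G1.
by rewrite (proof_irrelevance _ Fi Gi) (proof_irrelevance _ Fc Gc).
Qed.

Section Correspondence.
Variables (X : AddSymMonCat) (S : DifferentialModality X).

(** * Injectivity of the forgetful maps *)

Lemma sbar_alg_data_inj (P Q : Alg (sbar S)) :
  @sbar_alg_data X S P = @sbar_alg_data X S Q -> P = Q.
Proof.
case: P => [[A0 A1 phi] [nu0 nu1 c] a u]; case: Q => [[B0 B1 psi] [w0 w1 c'] a' u'].
rewrite /sbar_alg_data /= => E; injection E => E4 E3 E2 E1 E0.
subst B0 B1.
move: (inj_pair2 _ _ _ _ _ (inj_pair2 _ _ _ _ _ E2)) => {}E2.
move: (inj_pair2 _ _ _ _ _ E3) => {}E3.
move: (inj_pair2 _ _ _ _ _ (inj_pair2 _ _ _ _ _ E4)) => {}E4.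
(* The algebra laws mention the structure map as an arrow of [Arr X], including its proof of
   commutation, so those proofs are identified first. *)
subst psi w0 w1; move: (proof_irrelevance _ c c') => Ec; subst c'.
by rewrite (proof_irrelevance _ a a') (proof_irrelevance _ u u').
Qed.

Lemma der_data_inj (D D' : Der S) :
  @der_data X S D = @der_data X S D' -> D = D'.
Proof.
case: D => [[A nu a u] [M al ma mu] d l]; case: D' => [[A' nu' a' u'] [M' al' ma' mu'] d' l'].
rewrite /der_data /= in ma mu ma' mu' d d' l l' * => E; injection E => E4 E3 E2 E1 E0.
subst A' M'.
move: (inj_pair2 _ _ _ _ _ E2) => {}E2.
move: (inj_pair2 _ _ _ _ _ (inj_pair2 _ _ _ _ _ E3)) => {}E3.
move: (inj_pair2 _ _ _ _ _ (inj_pair2 _ _ _ _ _ E4)) => {}E4.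
subst nu' al' d'.
(* The module is taken over the monoid of the bundled algebra, so the algebra laws are identified
   before the module laws. *)
move: (proof_irrelevance _ a a') (proof_irrelevance _ u u') => Ea Eu; subst a' u'.
move: (proof_irrelevance _ ma ma') (proof_irrelevance _ mu mu') => Ema Emu; subst ma' mu'.
by rewrite (proof_irrelevance _ l l').
Qed.

Lemma MkMapPair_inj (A0 A1 B0 B1 : X) (f0 g0 : Hom A0 B0) (f1 g1 : Hom A1 B1) :
  MkMapPair f0 f1 = MkMapPair g0 g1 -> f0 = g0 /\ f1 = g1.
Proof.
move=> E; injection E => E1 E0; split.
- exact: (inj_pair2 _ _ _ _ _ (inj_pair2 _ _ _ _ _ E0)).
- exact: (inj_pair2 _ _ _ _ _ (inj_pair2 _ _ _ _ _ E1)).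
Qed.

Lemma sbar_alg_maps_inj (P Q : ALG (sbar S)) (f g : Hom P Q) :
  sbar_alg_maps f = sbar_alg_maps g -> f = g.
Proof.
by move=> /MkMapPair_inj [E0 E1]; apply: AlgHom_ext; apply: ArrHom_ext.
Qed.

Lemma der_maps_inj (D D' : DER S) (f g : Hom D D') : der_maps f = der_maps g -> f = g.
Proof. by move=> /MkMapPair_inj [E0 E1]; apply: DerHom_ext. Qed.

(** * From algebras of [sbar S] to derivations *)

Section DerivationOfAlgebra.
Variable P : Alg (sbar S).
Let A := arr0 (alg_ob P).
Let M := arr1 (alg_ob P).
Let phi : Hom A M := arr_map (alg_ob P).
Let nu0 : Hom (S A) A := arh0 (alg_str P).
Let nu1 : Hom (S A ⊗ M) M := arh1 (alg_str P).

Lemma sbar_alg_assoc0 : nu0 ∘ mon_mu S A = nu0 ∘ fmap S nu0.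
Proof. exact: (f_equal (fun f => arh0 f) (alg_assoc P)). Qed.

Lemma sbar_alg_unit0 : nu0 ∘ mon_eta S A = 1_A.
Proof. exact: (f_equal (fun f => arh0 f) (alg_unit P)). Qed.

Lemma sbar_alg_assoc1 :
  nu1 ∘ ((am_m S A ⊠ 1_M) ∘ assoc_inv (S A) (S A) M ∘ (mon_mu S A ⊠ 1_(S A ⊗ M)))
  = nu1 ∘ (fmap S nu0 ⊠ nu1).
Proof. by rewrite -tensm_id; exact: (f_equal (fun f => arh1 f) (alg_assoc P)). Qed.

Lemma sbar_alg_unit1 : nu1 ∘ ((am_u S A ⊠ 1_M) ∘ lunit_inv M) = 1_M.
Proof. exact: (f_equal (fun f => arh1 f) (alg_unit P)). Qed.

Definition sbar_alg_base : Alg S :=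
  {| alg_ob := A; alg_str := nu0;
     alg_assoc := sbar_alg_assoc0; alg_unit := sbar_alg_unit0 |}.

Definition sbar_alg_act : Hom (A ⊗ M) M := nu1 ∘ (mon_eta S A ⊠ 1_M).

Lemma sbar_alg_act_str : sbar_alg_act ∘ (nu0 ⊠ 1_M) = nu1.
Proof.
rewrite /sbar_alg_act -comp_assoc tens_comp1 mon_eta_nat.
(* Writing [1_M] by the unit law [sbar_alg_unit1] creates the factor [fmap S nu0 ⊠ nu1] to which
   [sbar_alg_assoc1] applies. Afterwards [eta] cancels against [mu] and [u] against the
   multiplication. *)
have -> : (fmap S nu0 ∘ mon_eta S (S A)) ⊠ 1_M
    = (fmap S nu0 ⊠ nu1) ∘ (mon_eta S (S A) ⊠ ((am_u S A ⊠ 1_M) ∘ lunit_inv M)).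
  by rewrite -tensm_comp sbar_alg_unit1.
rewrite comp_assoc -sbar_alg_assoc1 -!comp_assoc -tensm_comp mon_unitl comp_idl.
rewrite -tens1_comp (comp_assoc (assoc_inv _ _ _)) assoc_inv_nat !comp_assoc.
rewrite -(comp_assoc nu1) tens_comp1 (cmon_unitr (am_cmon S A)).
rewrite -!comp_assoc (comp_assoc (runit _ ⊠ _)) assoc_inv_triangle.
by rewrite comp_idr.
Qed.

Lemma sbar_alg_act_assoc :
  sbar_alg_act ∘ (1_A ⊠ sbar_alg_act) ∘ assoc A A M
  = sbar_alg_act ∘ (alg_mul sbar_alg_base ⊠ 1_M).
Proof.
rewrite /alg_mul -[_ ∘ am_m S A ∘ _]comp_assoc -tens_comp1 comp_assoc sbar_alg_act_str.
(* Expanding [1_A] as [nu0 ∘ eta] lets naturality of [eta] bring out [fmap S nu0 ⊠ nu1], so that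
   associativity of the algebra structure applies again. *)
rewrite -{1}sbar_alg_unit0 /sbar_alg_act.
have E : (mon_eta S A ⊠ 1_M) ∘ ((nu0 ∘ mon_eta S A) ⊠ (nu1 ∘ (mon_eta S A ⊠ 1_M)))
    = (fmap S nu0 ⊠ nu1)
      ∘ ((mon_eta S (S A) ⊠ 1_(S A ⊗ M)) ∘ (mon_eta S A ⊠ (mon_eta S A ⊠ 1_M))).
  by rewrite -!tensm_comp !comp_idl comp_assoc mon_eta_nat -comp_assoc.
rewrite -!comp_assoc (comp_assoc (mon_eta S A ⊠ _)) E -!comp_assoc.
rewrite (comp_assoc nu1) -sbar_alg_assoc1 -!comp_assoc.
rewrite (comp_assoc (mon_mu S A ⊠ _)) tens_comp1 mon_unitl tensm_id comp_idl.
rewrite (comp_assoc (assoc_inv _ _ _)) assoc_inv_nat -comp_assoc assocK comp_idr.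
by rewrite tens_comp1.
Qed.

Lemma sbar_alg_act_unit :
  sbar_alg_act ∘ (alg_one sbar_alg_base ⊠ 1_M) ∘ lunit_inv M = 1_M.
Proof.
by rewrite /alg_one -tens_comp1 comp_assoc sbar_alg_act_str -comp_assoc sbar_alg_unit1.
Qed.

Definition sbar_alg_mod : Module (alg_monoid sbar_alg_base) :=
  @Build_Module X (alg_monoid sbar_alg_base) M sbar_alg_act
    sbar_alg_act_assoc sbar_alg_act_unit.

(** By [sbar_alg_act_str] this is the commuting square that makes the structure map a map of
    [Arr X]. *)
Lemma sbar_alg_derivation :
  phi ∘ nu0 = sbar_alg_act ∘ (nu0 ⊠ phi) ∘ dm_d S A.
Proof.
have -> : nu0 ⊠ phi = (nu0 ⊠ 1_M) ∘ (1_(S A) ⊠ phi).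
  by rewrite -tensm_comp comp_idl comp_idr.
rewrite comp_assoc sbar_alg_act_str -comp_assoc.
by rewrite -(arh_comm (alg_str P)).
Qed.

Definition der_of_sbar : Der S :=
  @Build_Der X S sbar_alg_base sbar_alg_mod phi sbar_alg_derivation.

End DerivationOfAlgebra.

Section DerivationMorphism.
Variables (P Q : Alg (sbar S)) (f : AlgHom P Q).

Lemma sbar_alghom_comm0 :
  arh0 (ah_map f) ∘ arh0 (alg_str P) = arh0 (alg_str Q) ∘ fmap S (arh0 (ah_map f)).
Proof. exact: (f_equal (fun h => arh0 h) (ah_comm f)). Qed.

Definition alghom_of_sbar : AlgHom (sbar_alg_base P) (sbar_alg_base Q) :=
  @Build_AlgHom X S (sbar_alg_base P) (sbar_alg_base Q) _ sbar_alghom_comm0.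

Lemma sbar_alghom_act :
  arh1 (ah_map f) ∘ sbar_alg_act P
  = sbar_alg_act Q ∘ (arh0 (ah_map f) ⊠ arh1 (ah_map f)).
Proof.
have E : arh1 (ah_map f) ∘ arh1 (alg_str P)
    = arh1 (alg_str Q) ∘ (fmap S (arh0 (ah_map f)) ⊠ arh1 (ah_map f)).
  exact: (f_equal (fun h => arh1 h) (ah_comm f)).
rewrite /sbar_alg_act comp_assoc E -!comp_assoc -!tensm_comp.
by rewrite mon_eta_nat comp_idl comp_idr.
Qed.

Definition derhom_of_sbar : DerHom (der_of_sbar P) (der_of_sbar Q) :=
  @Build_DerHom X S (der_of_sbar P) (der_of_sbar Q) alghom_of_sbar (arh1 (ah_map f))
    sbar_alghom_act (arh_comm (ah_map f)).

End DerivationMorphism.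

Definition sbar_to_der : Functor (ALG (sbar S)) (DER S).
Proof.
refine (@Build_Functor (ALG (sbar S)) (DER S) der_of_sbar derhom_of_sbar _ _).
- by move=> P; apply: DerHom_ext.
- by move=> P Q R g f; apply: DerHom_ext.
Defined.

(** * From derivations to algebras of [sbar S] *)

Section AlgebraOfDerivation.
Variable D : Der S.
Let A := alg_ob (der_alg D).
Let M := mod_ob (der_mod D).
Let nu : Hom (S A) A := alg_str (der_alg D).
Let alpha : Hom (A ⊗ M) M := mod_act (der_mod D).

Definition der_arr : Arr X := @Build_ArrOb X A M (der_map D).

Definition der_str1 : Hom (S A ⊗ M) M := alpha ∘ (nu ⊠ 1_M).

(** The derivation law, read as the square required of a structure map in [Arr X]. *)
Lemma der_str_comm :
  der_str1 ∘ ((1_(S A) ⊠ der_map D) ∘ dm_d S A) = der_map D ∘ nu.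
Proof.
by rewrite der_law /der_str1 comp_assoc -(comp_assoc alpha) -tensm_comp comp_idl comp_idr.
Qed.

Definition der_str : Hom (sbar S der_arr) der_arr :=
  @Build_ArrHom X (sbar_ob S der_arr) der_arr nu der_str1 der_str_comm.

Lemma der_str_assoc : der_str ∘ mon_mu (sbar S) der_arr = der_str ∘ fmap (sbar S) der_str.
Proof.
apply: ArrHom_ext => /=; first exact: (alg_assoc (der_alg D)).
have mod_mul : alpha ∘ (alg_mul (der_alg D) ⊠ 1_M) = alpha ∘ (1_A ⊠ alpha) ∘ assoc A A M.
  by rewrite (mod_assoc (der_mod D)).
rewrite tensm_id /der_str1 -!comp_assoc (comp_assoc (nu ⊠ 1_M)) tens_comp1.
(* [nu] carries the multiplication of [S A] to that of [A], which turns the claim into associativity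
   of the module action. *)
rewrite -alg_mul_str -tens_comp1 -!comp_assoc (comp_assoc alpha) mod_mul.
rewrite -!comp_assoc (comp_assoc (assoc A A M)) assoc_nat -!comp_assoc.
rewrite (comp_assoc (assoc _ _ _)) assoc_invK comp_idl -!tensm_comp.
by rewrite (alg_assoc (der_alg D)) !comp_idl comp_idr.
Qed.

Lemma der_str_unit : der_str ∘ mon_eta (sbar S) der_arr = idm der_arr.
Proof.
apply: ArrHom_ext => /=; first exact: (alg_unit (der_alg D)).
rewrite /der_str1 comp_assoc -(comp_assoc alpha) tens_comp1.
exact: (mod_unit (der_mod D)).
Qed.

Definition sbar_of_der : Alg (sbar S) :=
  {| alg_ob := der_arr; alg_str := der_str;
     alg_assoc := der_str_assoc; alg_unit := der_str_unit |}.

End AlgebraOfDerivation.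

Section AlgebraMorphism.
Variables (D D' : Der S) (f : DerHom D D').

Definition arrhom_of_der : Hom (der_arr D) (der_arr D') :=
  @Build_ArrHom X (der_arr D) (der_arr D') (ah_map (dh_alg f)) (dh_mod f) (dh_comm f).

Lemma arrhom_of_der_str :
  arrhom_of_der ∘ der_str D = der_str D' ∘ fmap (sbar S) arrhom_of_der.
Proof.
apply: ArrHom_ext => /=; first exact: (ah_comm (dh_alg f)).
rewrite /der_str1 comp_assoc dh_act -!comp_assoc -!tensm_comp.
by rewrite (ah_comm (dh_alg f)) comp_idl comp_idr.
Qed.

Definition sbarhom_of_der : AlgHom (sbar_of_der D) (sbar_of_der D') :=
  @Build_AlgHom (Arr X) (sbar S) (sbar_of_der D) (sbar_of_der D') _ arrhom_of_der_str.

End AlgebraMorphism.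

Definition der_to_sbar : Functor (DER S) (ALG (sbar S)).
Proof.
refine (@Build_Functor (DER S) (ALG (sbar S)) sbar_of_der sbarhom_of_der _ _).
- by move=> D; apply: AlgHom_ext; apply: ArrHom_ext.
- by move=> D D' D'' g f; apply: AlgHom_ext; apply: ArrHom_ext.
Defined.

(** * The two functors are mutually inverse *)

Lemma der_to_sbarK : functor_comp der_to_sbar sbar_to_der = functor_id (ALG (sbar S)).
Proof.
apply: (functor_ext_data (data := @sbar_alg_maps X S)).
- exact: sbar_alg_maps_inj.
- move=> P; apply: sbar_alg_data_inj.
  (* Only [nu1] is rebuilt by the round trip; the other components return unchanged. *)
  by rewrite /sbar_alg_data /= /der_str1 /= sbar_alg_act_str.
- by [].
Qed.

Lemma sbar_to_derK : functor_comp sbar_to_der der_to_sbar = functor_id (DER S).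
Proof.
apply: (functor_ext_data (data := @der_maps X S)).
- exact: der_maps_inj.
- move=> D; apply: der_data_inj.
  (* Only the action changes form: it becomes [alpha ∘ ((nu ∘ eta) ⊠ 1)], and [nu ∘ eta] is the
     identity. *)
  rewrite /der_data /= /sbar_alg_act /= /der_str1 -comp_assoc tens_comp1.
  by rewrite (alg_unit (der_alg D)) tensm_id comp_idr.
- by [].
Qed.

End Correspondence.

Theorem theorem5p9 (X : DifferentialCategory) :
  let S := dc_mod X in
  exists (F : Functor (ALG (sbar S)) (DER S)) (G : Functor (DER S) (ALG (sbar S))),
    (forall P : ALG (sbar S), der_data (F P) = der_data_of_sbar (sbar_alg_data P)) /\
    (forall (P Q : ALG (sbar S)) (f : Hom P Q), der_maps (fmap F f) = sbar_alg_maps f) /\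
    (forall D : DER S, sbar_alg_data (G D) = sbar_data_of_der (der_data D)) /\
    (forall (D D' : DER S) (f : Hom D D'), sbar_alg_maps (fmap G f) = der_maps f) /\
    functor_comp G F = functor_id (ALG (sbar S)) /\
    functor_comp F G = functor_id (DER S).
Proof.
move=> S; exists (sbar_to_der S), (der_to_sbar S).
do 4 (split; first by []).
by split; [apply: der_to_sbarK | apply: sbar_to_derK].
Qed.
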